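(* Let $G$ be a group with neutral element $e$, let $A=\bigoplus_{g\in G}A_g$ be a finite dimensional $G$-graded algebra over a field $k$, and let $\sigma\in G$. The following assertions are equivalent. (i) $A$ is $\sigma$-graded Frobenius. (ii) $A_\sigma\simeq A_e^*$ as left $A_e$-modules, and $A$ is left $\sigma$-faithful. (iii) $A_\sigma\simeq A_e^*$ as right $A_e$-modules, and $A$ is right $\sigma$-faithful.
   Context: $A-gr$ denotes the category of $G$-graded left $A$-modules (with degree-preserving $A$-linear maps). For $M\in A-gr$ and $\sigma\in G$, the suspension $M(\sigma)$ is $M$ as an $A$-module with grading $M(\sigma)_g=M_{g\sigma}$. The dual space $A^*=\mathrm{Hom}_k(A,k)$ is a graded left $A$-module with $(af)(x)=f(xa)$ and grading $(A^* )_g=\{f\in A^* \mid f(A_h)=0 \text{ for any } h\neq g^{-1}\}$. $A$ is called $\sigma$-graded Frobenius if $A(\sigma)\simeq A^*$ in $A-gr$. $A_e^*=\mathrm{Hom}_k(A_e,k)$ is a left $A_e$-module by $(af)(x)=f(xa)$ and a right $A_e$-module by $(fa)(x)=f(ax)$. $A$ is left $\sigma$-faithful if $A_{\sigma g^{-1}}a_g\neq 0$ for any $g\in G$ and any non-zero $a_g\in A_g$. $A$ is right $\sigma$-faithful if $a_gA_{g^{-1}\sigma}\neq 0$ for any $g\in G$ and any non-zero $a_g\in A_g$. *)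

(* Defs.v *)
From HB Require Import structures.
From mathcomp Require Import all_boot all_algebra all_field.

Set Implicit Arguments.
Unset Strict Implicit.
Unset Printing Implicit Defensive.

Import GRing.Theory.
Local Open Scope ring_scope.

(* The index type may be infinite, hence the sums over finite sequences; C i is
   meant to be an additive subgroup of V. *)
Definition is_direct_sum (I : eqType) (V : zmodType) (C : I -> V -> Prop) :=
  (forall v : V, exists (s : seq I) (f : I -> V),
      [/\ uniq s, forall i, C i (f i) & v = \sum_(i <- s) f i]) /\
  (forall (s : seq I) (f : I -> V), uniq s -> (forall i, C i (f i)) ->
      \sum_(i <- s) f i = 0 -> forall i, i \in s -> f i = 0).

(* That 1 lies in the component of degree 1%g is a consequence of these axioms,
   see one_in_grcomp. *)
Record grading (G : groupType) (k : fieldType) (A : falgType k) := Grading {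
  grcomp :> G -> {vspace A};
  grcomp_direct : is_direct_sum (fun g (a : A) => a \in grcomp g);
  grcompM : forall g h a b,
    a \in grcomp g -> b \in grcomp h -> a * b \in grcomp (g * h)%g
}.

(* The k-dual of A as a left A-module: (a *: f) x = f (x * a). *)
Definition ldual (k : fieldType) (A : falgType k) : Type := 'Hom(A, k^o).

Section LeftDual.
Variables (k : fieldType) (A : falgType k).

HB.instance Definition _ := GRing.Zmodule.copy (ldual A) 'Hom(A, k^o).

Definition ldual_scale (a : A) (f : ldual A) : ldual A :=
  ((f : 'Hom(A, k^o)) \o amulr a)%VF.

Lemma ldual_scaleE a (f : ldual A) x :
  (ldual_scale a f : 'Hom(A, k^o)) x = (f : 'Hom(A, k^o)) (x * a).
Proof. by rewrite /ldual_scale comp_lfunE lfunE. Qed.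

Fact ldual_scalerA a b f :
  ldual_scale a (ldual_scale b f) = ldual_scale (a * b) f.
Proof. by apply/lfunP => x; rewrite !ldual_scaleE mulrA. Qed.

Fact ldual_scale1r : left_id 1 ldual_scale.
Proof. by move=> f; apply/lfunP => x; rewrite ldual_scaleE mulr1. Qed.

Fact ldual_scalerDr : right_distributive ldual_scale +%R.
Proof.
by move=> a f g; apply/lfunP => x; rewrite !(ldual_scaleE, add_lfunE).
Qed.

Fact ldual_scalerDl f : {morph ldual_scale^~ f : a b / a + b}.
Proof.
by move=> a b; apply/lfunP => x; rewrite add_lfunE !ldual_scaleE mulrDr linearD.
Qed.

HB.instance Definition _ := GRing.Zmodule_isLmodule.Build A (ldual A)
  ldual_scalerA ldual_scale1r ldual_scalerDr ldual_scalerDl.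

End LeftDual.

(* The k-dual of A as a right A-module, i.e. as a left module over the converse
   ring A^c: (a *: f) x = f (a * x). *)
Definition rdual (k : fieldType) (A : falgType k) : Type := 'Hom(A, k^o).

Section RightDual.
Variables (k : fieldType) (A : falgType k).

HB.instance Definition _ := GRing.Zmodule.copy (rdual A) 'Hom(A, k^o).

Definition rdual_scale (a : A^c) (f : rdual A) : rdual A :=
  ((f : 'Hom(A, k^o)) \o amull (a : A))%VF.

Lemma rdual_scaleE (a : A) (f : rdual A) x :
  (rdual_scale a f : 'Hom(A, k^o)) x = (f : 'Hom(A, k^o)) (a * x).
Proof. by rewrite /rdual_scale comp_lfunE lfunE. Qed.

Fact rdual_scalerA (a b : A^c) f :
  rdual_scale a (rdual_scale b f) = rdual_scale (a * b) f.
Proof. by apply/lfunP => x; rewrite !rdual_scaleE mulrA. Qed.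

Fact rdual_scale1r : left_id 1 rdual_scale.
Proof. by move=> f; apply/lfunP => x; rewrite rdual_scaleE mul1r. Qed.

Fact rdual_scalerDr : right_distributive rdual_scale +%R.
Proof.
by move=> a f g; apply/lfunP => x; rewrite !(rdual_scaleE, add_lfunE).
Qed.

Fact rdual_scalerDl f : {morph rdual_scale^~ f : a b / a + b}.
Proof.
by move=> a b; apply/lfunP => x; rewrite add_lfunE !rdual_scaleE mulrDl linearD.
Qed.

HB.instance Definition _ := GRing.Zmodule_isLmodule.Build A^c (rdual A)
  rdual_scalerA rdual_scale1r rdual_scalerDr rdual_scalerDl.

End RightDual.

Section GradedAlgebra.
Variables (G : groupType) (k : fieldType) (A : falgType k) (Gr : grading G A).

Lemma grading_support :
  exists s : seq G, uniq s /\ forall a : A, exists f : G -> A,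
    (forall g, f g \in Gr g) /\ a = \sum_(g <- s) f g.
Proof.
have [span _] := grcomp_direct Gr.
have H (r : seq A) : exists s : seq G, uniq s /\ forall a, a \in <<r>>%VS ->
    exists f : G -> A, (forall g, f g \in Gr g) /\ a = \sum_(g <- s) f g.
  elim: r => [|v r [s [us Hs]]].
    exists [::]; split=> // a; rewrite span_nil memv0 => /eqP ->.
    by exists (fun=> 0); split=> [g|]; rewrite ?mem0v ?big_nil.
  have [s' [f' [us' Hf' ->]]] := span v.
  have ext (t u : seq G) (h : G -> A) : uniq t -> uniq u -> {subset t <= u} ->
      \sum_(g <- t) h g = \sum_(g <- u) (if g \in t then h g else 0).
    move=> ut uu tu; rewrite -big_mkcond -big_filter; apply: perm_big.
    apply: uniq_perm => //; first exact: filter_uniq.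
    by move=> x; rewrite mem_filter; case: (boolP (x \in t)) => //= /tu.
  have sub1 : {subset s' <= undup (s' ++ s)}.
    by move=> x xs; rewrite mem_undup mem_cat xs.
  have sub2 : {subset s <= undup (s' ++ s)}.
    by move=> x xs; rewrite mem_undup mem_cat xs orbT.
  exists (undup (s' ++ s)); split=> [|a]; first exact: undup_uniq.
  rewrite span_cons => /memv_addP[_ /vlineP[c ->] [b /Hs[f [Hf ->]] ->]].
  exists (fun g => c *: (if g \in s' then f' g else 0)
                   + (if g \in s then f g else 0)).
  split=> [g|].
    by rewrite memvD ?memvZ //; case: ifP; rewrite ?mem0v.
  by rewrite big_split /= -scaler_sumr -!ext ?undup_uniq.
have [s [us Hs]] := H (vbasis (fullv : {vspace A})).
exists s; split=> // a; apply: Hs.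
by rewrite (span_basis (vbasisP _)) memvf.
Qed.

Lemma grcomp_eq (s : seq G) (f f' : G -> A) : uniq s ->
  (forall g, f g \in Gr g) -> (forall g, f' g \in Gr g) ->
  \sum_(g <- s) f g = \sum_(g <- s) f' g -> forall g, g \in s -> f g = f' g.
Proof.
move=> us Hf Hf' E g gs; apply/eqP; rewrite -subr_eq0; apply/eqP.
have [_ indep] := grcomp_direct Gr.
apply: (indep s (fun g => f g - f' g)) => // [h|]; first by rewrite memvB.
by rewrite sumrB E subrr.
Qed.

Lemma one_in_grcomp : 1 \in Gr 1%g.
Proof.
have [s [us Hs]] := grading_support.
have [f [Hf E]] := Hs 1.
pose s1 := undup (1%g :: s).
have us1 : uniq s1 by exact: undup_uniq.
pose f1 g := if g \in s then f g else 0.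
have Hf1 g : f1 g \in Gr g by rewrite /f1; case: ifP; rewrite ?mem0v.
have E1 : 1 = \sum_(g <- s1) f1 g.
  rewrite E /f1 -big_mkcond -big_filter; apply: perm_big.
  apply: uniq_perm => //; first exact: filter_uniq.
  by move=> x; rewrite mem_filter mem_undup inE; case: (x \in s); rewrite ?orbT.
(* f1 1 is a left unit on each homogeneous component *)
have key h (a : A) : a \in Gr h -> f1 1%g * a = a.
  move=> ah; pose t := [seq (g * h)%g | g <- s1].
  have ut : uniq t by rewrite map_inj_uniq //; exact: mulIg.
  have ht : h \in t.
    by apply/mapP; exists 1%g; rewrite ?mul1g // mem_undup inE eqxx.
  pose F g := f1 (g * h^-1)%g * a.
  pose F' g := if g == h then a else 0.
  have -> : f1 1%g * a = F h by rewrite /F mulgV.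
  have -> : a = F' h by rewrite /F' eqxx.
  apply: (@grcomp_eq t) => // [g|g|].
  - by rewrite -{2}[g](mulgVK h) grcompM.
  - by rewrite /F'; case: eqP => [->|_]; rewrite ?mem0v.
  - have -> : \sum_(g <- t) F' g = a.
      rewrite (bigD1_seq h) //= /F' eqxx big1 ?addr0 // => g /negPf -> //.
    rewrite big_map -[RHS]mul1r E1 mulr_suml.
    by apply: eq_bigr => g _; rewrite /F mulgK.
have E2 : f1 1%g * (\sum_(g <- s1) f1 g) = \sum_(g <- s1) f1 g.
  by rewrite mulr_sumr; apply: eq_bigr => g _; exact: key (Hf1 g).
by rewrite -E1 mulr1 in E2; rewrite -E2.
Qed.

(* The subalgebra of degree 1%g has the same unit as A, see algid_grcomp1. *)
Fact grcomp1_is_aspace : is_aspace (Gr 1%g).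
Proof.
rewrite /is_aspace has_algid1 ?one_in_grcomp //=.
by apply/prodvP => a b Ha Hb; rewrite -[1%g]mulg1 grcompM.
Qed.

Definition grcomp1 : {aspace A} := ASpace grcomp1_is_aspace.

Lemma algid_grcomp1 : algid grcomp1 = 1.
Proof. by apply/eqP; rewrite algid_eq1 one_in_grcomp. Qed.

End GradedAlgebra.

(* The homogeneous component of degree s, as a left and as a right module over
   the subalgebra of degree 1%g; right modules are encoded as left modules over
   the converse ring. *)
Definition lcomp (G : groupType) (k : fieldType) (A : falgType k)
  (Gr : grading G A) (s : G) : Type := subvs_of (Gr s).
Definition rcomp (G : groupType) (k : fieldType) (A : falgType k)
  (Gr : grading G A) (s : G) : Type := subvs_of (Gr s).

Section ComponentModules.
Variables (G : groupType) (k : fieldType) (A : falgType k) (Gr : grading G A).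
Variable s : G.
Local Notation Ae := (subvs_of (grcomp1 Gr)).

HB.instance Definition _ := GRing.Zmodule.copy (lcomp Gr s) (subvs_of (Gr s)).
HB.instance Definition _ := GRing.Zmodule.copy (rcomp Gr s) (subvs_of (Gr s)).

Fact lcomp_scale_subproof (a : Ae) (x : subvs_of (Gr s)) :
  vsval a * vsval x \in Gr s.
Proof. by have := grcompM (subvsP a) (subvsP x); rewrite mul1g. Qed.

Definition lcomp_scale (a : Ae) (x : lcomp Gr s) : lcomp Gr s :=
  Subvs (lcomp_scale_subproof a x).

Fact lcomp_scalerA a b x :
  lcomp_scale a (lcomp_scale b x) = lcomp_scale (a * b) x.
Proof. by apply: val_inj; rewrite /= mulrA. Qed.

Fact lcomp_scale1r : left_id 1 lcomp_scale.
Proof. by move=> x; apply: val_inj; rewrite /= algid_grcomp1 mul1r. Qed.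

Fact lcomp_scalerDr : right_distributive lcomp_scale +%R.
Proof. by move=> a x y; apply: val_inj; rewrite /= mulrDr. Qed.

Fact lcomp_scalerDl x : {morph lcomp_scale^~ x : a b / a + b}.
Proof. by move=> a b; apply: val_inj; rewrite /= mulrDl. Qed.

HB.instance Definition _ := GRing.Zmodule_isLmodule.Build Ae (lcomp Gr s)
  lcomp_scalerA lcomp_scale1r lcomp_scalerDr lcomp_scalerDl.

Fact rcomp_scale_subproof (a : Ae) (x : subvs_of (Gr s)) :
  vsval x * vsval a \in Gr s.
Proof. by have := grcompM (subvsP x) (subvsP a); rewrite mulg1. Qed.

Definition rcomp_scale (a : Ae^c) (x : rcomp Gr s) : rcomp Gr s :=
  Subvs (rcomp_scale_subproof a x).

Fact rcomp_scalerA (a b : Ae^c) x :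
  rcomp_scale a (rcomp_scale b x) = rcomp_scale (a * b) x.
Proof. by apply: val_inj; rewrite /= mulrA. Qed.

Fact rcomp_scale1r : left_id 1 rcomp_scale.
Proof. by move=> x; apply: val_inj; rewrite /= algid_grcomp1 mulr1. Qed.

Fact rcomp_scalerDr : right_distributive rcomp_scale +%R.
Proof. by move=> a x y; apply: val_inj; rewrite /= mulrDl. Qed.

Fact rcomp_scalerDl x : {morph rcomp_scale^~ x : a b / a + b}.
Proof. by move=> a b; apply: val_inj; rewrite /= mulrDr. Qed.

HB.instance Definition _ := GRing.Zmodule_isLmodule.Build Ae^c (rcomp Gr s)
  rcomp_scalerA rcomp_scale1r rcomp_scalerDr rcomp_scalerDl.

End ComponentModules.

Definition lmod_iso (R : pzRingType) (M N : lmodType R) : Prop :=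
  exists f : {linear M -> N}, bijective f.
Arguments lmod_iso : clear implicits.

Section GradedModules.
Variables (G : groupType) (k : fieldType) (A : falgType k) (Gr : grading G A).

Record grmod := GrMod {
  grmod_sort :> lmodType A;
  grmod_comp : G -> grmod_sort -> Prop;
  grmod_comp0 : forall g, grmod_comp g 0;
  grmod_compB : forall g x y,
    grmod_comp g x -> grmod_comp g y -> grmod_comp g (x - y);
  grmod_direct : is_direct_sum grmod_comp;
  grmod_scale : forall g h a x,
    a \in Gr g -> grmod_comp h x -> grmod_comp (g * h)%g (a *: x)
}.

Record grhom (M N : grmod) := GrHom {
  grhom_fun :> {linear M -> N};
  grhom_deg : forall g x, grmod_comp g x -> grmod_comp g (grhom_fun x)
}.

Definition grmod_iso (M N : grmod) : Prop :=
  exists (f : grhom M N) (f' : grhom N M), cancel f f' /\ cancel f' f.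

(* A^o is A viewed as a left module over itself. *)
Definition regular_comp (g : G) (a : A^o) : Prop := (a : A) \in Gr g.

Fact regular_comp0 g : regular_comp g 0.
Proof. exact: mem0v. Qed.

Fact regular_compB g x y :
  regular_comp g x -> regular_comp g y -> regular_comp g (x - y).
Proof. exact: memvB. Qed.

Fact regular_comp_scale g h (a : A) (x : A^o) :
  a \in Gr g -> regular_comp h x -> regular_comp (g * h)%g (a *: x).
Proof. exact: grcompM. Qed.

Definition gr_regular : grmod :=
  @GrMod (A^o : lmodType A) regular_comp regular_comp0 regular_compB
    (grcomp_direct Gr) regular_comp_scale.

Section Suspension.
Variables (M : grmod) (s : G).

Definition suspension_comp (g : G) (x : M) : Prop := grmod_comp (g * s)%g x.

Fact suspension_direct : is_direct_sum suspension_comp.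
Proof.
have [span indep] := grmod_direct M; split=> [v|t f ut Hf E g gt].
  have [t [f [ut Hf ->]]] := span v.
  exists [seq (g * s^-1)%g | g <- t], (fun g => f (g * s)%g); split.
  - by rewrite map_inj_uniq //; exact: mulIg.
  - by move=> g; exact: Hf.
  - by rewrite big_map; apply: eq_bigr => g _; rewrite mulgVK.
have := indep [seq (g * s)%g | g <- t] (fun g => f (g * s^-1)%g).
move=> /(_ _ _ _ (g * s)%g); rewrite mulgK; apply.
- by rewrite map_inj_uniq //; exact: mulIg.
- by move=> h; have := Hf (h * s^-1)%g; rewrite /suspension_comp mulgVK.
- by rewrite big_map -[RHS]E; apply: eq_bigr => h _; rewrite mulgK.
- exact: map_f.
Qed.

Fact suspension_scale g h (a : A) (x : M) :
  a \in Gr g -> suspension_comp h x -> suspension_comp (g * h)%g (a *: x).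
Proof. by move=> ag xh; rewrite /suspension_comp -mulgA; exact: grmod_scale. Qed.

Definition suspension : grmod :=
  @GrMod M suspension_comp (fun g => grmod_comp0 M (g * s)%g)
    (fun g => @grmod_compB M (g * s)%g) suspension_direct suspension_scale.

End Suspension.

Definition dual_comp (g : G) (f : ldual A) : Prop :=
  forall h, h != g^-1%g -> forall x, x \in Gr h -> (f : 'Hom(A, k^o)) x = 0.

Fact dual_comp0 g : dual_comp g 0.
Proof. by move=> h _ x _; rewrite zero_lfunE. Qed.

Fact dual_compB g x y : dual_comp g x -> dual_comp g y -> dual_comp g (x - y).
Proof.
move=> Hx Hy h hg z zh.
by rewrite add_lfunE opp_lfunE (Hx h) // (Hy h) // subrr.
Qed.

Fact dual_comp_scale g h (a : A) (f : ldual A) :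
  a \in Gr g -> dual_comp h f -> dual_comp (g * h)%g (a *: f).
Proof.
move=> ag Hf l lgh x xl; rewrite ldual_scaleE.
apply: (Hf (l * g)%g); last exact: grcompM.
by apply: contraNneq lgh => E; rewrite invgM -E mulgK.
Qed.

Fact dual_direct : is_direct_sum dual_comp.
Proof.
have [s [us Hs]] := grading_support Gr.
split=> [f|t F ut HF E h ht].
  have sV : (fullv = \sum_(g <- s) Gr g)%VS.
    apply/esym/eqP; rewrite eqEsubv subvf /=; apply/subvP => a _.
    have [u [Hu ->]] := Hs a.
    rewrite [X in X \in _]big_seq; apply: memv_suml => g gs.
    by apply: (subvP _ _ (Hu g)); rewrite (bigD1_seq g) //= addvSl.
  pose pi g : 'End(A) := linfun (sumv_pi_for sV g).
  have piE g x : pi g x = sumv_pi_for sV g x by rewrite lfunE.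
  have pi_mem g x : pi g x \in Gr g by rewrite piE memv_sum_pi.
  have pi_sum x : \sum_(g <- s) pi g x = x.
    under eq_bigr do rewrite piE.
    by rewrite sumv_pi_uniq_sum ?memvf ?filter_uniq.
  have pi0 g h x : g \in s -> h != g -> x \in Gr h -> pi g x = 0.
    move=> gs hg xh; case: (boolP (h \in s)) => hs.
      have -> : 0 = (if g == h then x else 0) by rewrite eq_sym (negPf hg).
      apply: (@grcomp_eq _ _ _ Gr s (pi^~ x) (fun l => if l == h then x else 0)).
      - by [].
      - by move=> l; exact: pi_mem.
      - by move=> l; case: eqP => [->|_]; rewrite ?mem0v.
      - rewrite pi_sum (bigD1_seq h) //= eqxx big1 ?addr0 //.
        by move=> l /negPf ->.
      - by [].
    have x0 : x = 0.
      pose w l := if l == h then - x else pi l x.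
      have [_ indep] := grcomp_direct Gr.
      apply/eqP; rewrite -oppr_eq0; apply/eqP.
      have -> : - x = w h by rewrite /w eqxx.
      apply: (indep (h :: s) w); rewrite /= ?hs ?mem_head //.
        by move=> l; rewrite /w; case: eqP => [->|_]; rewrite ?rpredN.
      rewrite big_cons /w eqxx -[X in _ + X = _](_ : x = _) ?addNr //.
      rewrite -{1}[x]pi_sum; apply: eq_big_seq => l ls.
      by case: eqP => // lh; rewrite -lh ls in hs.
    by rewrite x0 linear0.
  pose f0 : 'Hom(A, k^o) := f.
  exists [seq g^-1%g | g <- s].
  exists (fun h => if h^-1%g \in s then (f0 \o pi h^-1%g)%VF : ldual A else 0).
  split.
  - by rewrite map_inj_uniq //; exact: invg_inj.
  - move=> g; case: ifP => [gs|_]; last exact: dual_comp0.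
    by move=> h hg x xh; rewrite comp_lfunE (pi0 _ h) // linear0.
  - apply/lfunP => x; rewrite big_map sum_lfunE -{1}[x]pi_sum linear_sum /=.
    by apply: eq_big_seq => g gs; rewrite invgK gs comp_lfunE.
apply/lfunP => x; rewrite zero_lfunE.
have [u [Hu ->]] := Hs x; rewrite linear_sum big1 // => g _ /=.
have [gh|gh] := eqVneq g h^-1%g; last exact: (HF h g gh _ (Hu g)).
have := congr1 (fun f : 'Hom(A, k^o) => f (u g)) E.
rewrite zero_lfunE sum_lfunE (bigD1_seq h) //= big1 ?addr0 // => l lh.
apply: (HF l g _ _ (Hu g)); rewrite gh.
by apply: contraNneq lh => /invg_inj ->.
Qed.

Definition gr_dual : grmod :=
  @GrMod (ldual A : lmodType A) dual_comp dual_comp0 dual_compB dual_direct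
    dual_comp_scale.

Definition graded_Frobenius (s : G) : Prop :=
  grmod_iso (suspension gr_regular s) gr_dual.

Definition left_faithful (s : G) : Prop :=
  forall g a, a \in Gr g -> a != 0 ->
    exists2 b, b \in Gr (s * g^-1)%g & b * a != 0.

Definition right_faithful (s : G) : Prop :=
  forall g a, a \in Gr g -> a != 0 ->
    exists2 b, b \in Gr (g^-1 * s)%g & a * b != 0.

End GradedModules.

(* Main.v *)
From HB Require Import structures.
Require Import Defs.
From mathcomp Require Import all_boot all_algebra all_field.

Set Implicit Arguments.
Unset Strict Implicit.
Unset Printing Implicit Defensive.

Import GRing.Theory.
Local Open Scope ring_scope.

(** A graded isomorphism from A(s) to the dual of A is determined by the
    functional lam that is the image of 1: it sends a to x |-> lam (x * a).
    Since 1 has degree s^-1 in A(s), lam vanishes on every component except the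
    one of degree s. So A is s-graded Frobenius exactly when there is such a lam
    for which the form (a, x) |-> lam (x * a) is nondegenerate
    ([graded_FrobeniusP]). On a finite dimensional space nondegeneracy is
    symmetric in the two variables ([nondegenerate_flip]), so this condition
    does not distinguish left from right, and one argument, together with its
    mirror image, gives both equivalences.

    As lam lives in degree s, a component A_g pairs only with the component of
    its partner degree, which is s g^-1 for the form above and g^-1 s for its
    transpose. Therefore nondegeneracy can be tested on homogeneous elements
    ([nondegenerate_homogeneous], [homogeneous_nondegenerate]).

    From lam to the component condition: a nonzero a in A_g has some x in
    the partner component with lam (x * a) != 0, hence x * a != 0, which is
    faithfulness; and A_s, A_e are partners of each other, so the form restricts
    to a perfect pairing between them ([component_perfect]), which is an
    A_e-linear isomorphism of A_s with the dual of A_e.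

    Conversely, let phi be an isomorphism of A_s with the dual of A_e. Put
    lam (a) = phi a 1 on A_s and lam = 0 on the other components; then
    lam (x * a) = phi a x for x in A_e and a in A_s. If a in A_g is nonzero,
    faithfulness gives y with y * a nonzero in A_s, and injectivity of phi gives
    x in A_e with lam (x * y * a) = phi (y * a) x != 0. *)

(** * Nondegenerate pairings of finite dimensional spaces *)

(** The choice structure on the source provides the inverse function. *)
Lemma inj_surj_bij (S T : choiceType) (f : S -> T) :
  injective f -> (forall y, exists x, f x = y) -> bijective f.
Proof.
move=> fI fS; have ex y : exists x, f x == y.
  by have [x <-] := fS y; exists x.
have fK : cancel (fun y => xchoose (ex y)) f.
  by move=> y; apply/eqP/(xchooseP (ex y)).
by exists (fun y => xchoose (ex y)) => // x; apply: fI; rewrite fK.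
Qed.

Section Pairing.
Context {k : fieldType}.

Definition bilinear_form {V W : vectType k} (b : V -> W -> k^o) :=
  (forall w, linear (b^~ w)) /\ (forall v, linear (b v)).

(** Only the kernel on the left is required to vanish; the left and the right
    condition coincide when the dimensions agree, see [nondegenerate_flip]. *)
Definition nondegenerate {V W : vectType k} (b : V -> W -> k^o) :=
  forall v, (forall w, b v w = 0) -> v = 0.

Lemma bilinear_flip (V W : vectType k) (b : V -> W -> k^o) :
  bilinear_form b -> bilinear_form (fun w v => b v w).
Proof. by case. Qed.

(** Forms are kept as plain functions, so that flipping the two arguments is
    definitional; this recovers the bundled maps on which kernels, images and
    sums can be taken. *)
Lemma functional_of_linear (V : vectType k) (f : V -> k^o) :
  linear f -> exists F : 'Hom(V, k^o), F =1 f.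
Proof.
move=> lf; pose L := GRing.isLinear.Build k V k^o *%R f lf.
pose f' : {linear V -> k^o} := HB.pack f L.
by exists (linfun f') => x; rewrite lfunE.
Qed.

Lemma nonzero_functional (V : vectType k) (f : 'Hom(V, k^o)) :
  f != 0 -> exists v, f v != 0.
Proof.
move=> f0; have /subvPn[v _] : ~~ (fullv <= lker f)%VS.
  apply: contra f0 => /subvP sf; apply/eqP/lfunP => v.
  by rewrite zero_lfunE; apply/eqP; rewrite -memv_ker sf ?memvf.
by rewrite memv_ker; exists v.
Qed.

Lemma curry_form (V W : vectType k) (b : V -> W -> k^o) : bilinear_form b ->
  exists T : 'Hom(V, 'Hom(W, k^o)), forall v w, T v w = b v w.
Proof.
move=> [bl br].
pose c v : 'Hom(W, k^o) :=
  linfun (HB.pack (b v) (GRing.isLinear.Build k W k^o *%R (b v) (br v))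
     : {linear W -> k^o}).
have cE v w : c v w = b v w by rewrite /c lfunE.
have cl : linear c.
  by move=> x u v; apply/lfunP => w; rewrite add_lfunE scale_lfunE !cE bl.
pose c' : {linear V -> 'Hom(W, k^o)} :=
  HB.pack c (GRing.isLinear.Build k V 'Hom(W, k^o) *:%R c cl).
by exists (linfun c') => v w; rewrite lfunE /= cE.
Qed.

Lemma dim_dual (W : vectType k) : \dim {:'Hom(W, k^o)} = \dim {:W}.
Proof. by rewrite !dimvf /dim /= muln1. Qed.

Lemma nondegenerate_lker (V W : vectType k) (b : V -> W -> k^o)
    (T : 'Hom(V, 'Hom(W, k^o))) :
  (forall v w, T v w = b v w) -> nondegenerate b -> (lker T == 0)%VS.
Proof.
move=> TE nb; apply/eqP/vspaceP => v; rewrite memv_ker memv0.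
apply/eqP/eqP => [Tv|->]; last by rewrite linear0.
by apply: nb => w; rewrite -TE Tv zero_lfunE.
Qed.

Lemma nondegenerate_dim (V W : vectType k) (b : V -> W -> k^o) :
  bilinear_form b -> nondegenerate b -> (\dim {:V} <= \dim {:W})%N.
Proof.
move=> /curry_form[T TE] /(nondegenerate_lker TE) /eqP kT.
by rewrite -(dim_dual W) -(@limg_dim_eq _ _ _ T) ?dimvS ?subvf // kT capv0.
Qed.

Lemma nondegenerate_riesz (V W : vectType k) (b : V -> W -> k^o) :
  bilinear_form b -> nondegenerate b -> \dim {:V} = \dim {:W} ->
  forall f : 'Hom(W, k^o), exists v, forall w, b v w = f w.
Proof.
move=> /curry_form[T TE] /(nondegenerate_lker TE) /eqP kT dVW f.
have imT : limg T = fullv.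
  apply/eqP; rewrite eqEdim subvf /= dim_dual -dVW.
  by rewrite (@limg_dim_eq _ _ _ T) // kT capv0.
have : f \in limg T by rewrite imT memvf.
by case/memv_imgP => v _ ->; exists v => w; rewrite TE.
Qed.

(** If w is killed by every [b v], it is killed by every functional, since all
    of them have the form [b v]; its coordinates are among them. *)
Lemma nondegenerate_flip (V W : vectType k) (b : V -> W -> k^o) :
  bilinear_form b -> nondegenerate b -> \dim {:V} = \dim {:W} ->
  nondegenerate (fun w v => b v w).
Proof.
move=> bb nb dVW w bw0.
rewrite (coord_vbasis (memvf w)) big1 // => i _.
have [v vf] := nondegenerate_riesz bb nb dVW
    (linfun (coord (vbasis fullv) i : W -> k^o)).
by have := vf w; rewrite lfunE bw0 => <-; rewrite scale0r.
Qed.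

End Pairing.

(** * Graded forms *)

Section GradedForm.
Context {G : groupType} {k : fieldType} {A : falgType k} (Gr : grading G A).

(** Each component pairs only with one other, whose degree is given by [p]. The
    partner map is a parameter because a form and its transpose have different
    partner maps. *)
Definition graded_form (b : A -> A -> k^o) (p : G -> G) :=
  forall g h a x, a \in Gr g -> x \in Gr h -> h != p g -> b a x = 0.

Context (b : A -> A -> k^o) (p : G -> G).
Hypotheses (bb : bilinear_form b) (bp : graded_form b p) (pI : injective p).

(** Pairing with an element of the partner degree [p g] isolates the component
    of degree g, as no other degree has that partner. *)
Lemma graded_form_component (t : seq G) (f : G -> A) g x :
  uniq t -> (forall h, f h \in Gr h) -> g \in t -> x \in Gr (p g) ->
  b (\sum_(h <- t) f h) x = b (f g) x.
Proof.
move=> ut Hf gt xg; have [F FE] := functional_of_linear (bb.1 x).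
rewrite -!FE linear_sum (bigD1_seq g) //= big1 ?addr0 // => h hg.
by rewrite FE (bp (Hf h) xg) // (inj_eq pI) eq_sym.
Qed.

(** If a paired trivially with the component of degree [p g], it would pair
    trivially with every component, hence with all of A. *)
Lemma nondegenerate_homogeneous g a : nondegenerate b ->
  a \in Gr g -> a != 0 -> exists2 x, x \in Gr (p g) & b a x != 0.
Proof.
move=> nb ag; have [F FE] := functional_of_linear (bb.2 a).
have [/subvP sF|/subvPn[x xg]] := boolP (Gr (p g) <= lker F)%VS; last first.
  by rewrite memv_ker FE; exists x.
case/eqP; apply: nb => x.
have [t [f [ut Hf ->]]] := (grcomp_direct Gr).1 x.
rewrite -FE linear_sum big1 // => h _ /=.
have [hg|hg] := eqVneq h (p g); last by rewrite FE (bp ag (Hf h)).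
by apply/eqP; rewrite -memv_ker sF // -hg.
Qed.

Lemma homogeneous_nondegenerate :
  (forall g a, a \in Gr g -> a != 0 ->
     exists2 x, x \in Gr (p g) & b a x != 0) -> nondegenerate b.
Proof.
move=> Hb a a0; have [t [f [ut Hf Ea]]] := (grcomp_direct Gr).1 a.
rewrite Ea big_seq big1 // => g gt; apply/eqP/negPn/negP => /(Hb _ _ (Hf g)).
by case=> x xg /eqP[]; rewrite -(graded_form_component ut Hf gt xg) -Ea.
Qed.

(** A graded nondegenerate form also has a graded inverse: if a had a nonzero
    component in a degree h other than g, that component would pair nontrivially
    with some element of degree [p h], on which [b a] vanishes. *)
Lemma nondegenerate_degree g a : nondegenerate b ->
  (forall h x, x \in Gr h -> h != p g -> b a x = 0) -> a \in Gr g.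
Proof.
move=> nb Ha; have [t [f [ut Hf Ea]]] := (grcomp_direct Gr).1 a.
rewrite Ea big_seq; apply: memv_suml => h ht.
have [->|hg] := eqVneq h g; first exact: Hf.
suff -> : f h = 0 by exact: mem0v.
apply/eqP/negPn/negP => /(nondegenerate_homogeneous nb (Hf h))[x xh /eqP[]].
rewrite -(graded_form_component ut Hf ht xh) -Ea (Ha _ _ xh) //.
by rewrite (inj_eq pI).
Qed.

Definition component_form g h (v : subvs_of (Gr g)) (w : subvs_of (Gr h)) :=
  b (vsval v) (vsval w).

Lemma bilinear_component_form g h : bilinear_form (@component_form g h).
Proof.
by split=> w x u v; rewrite /component_form linearP ?bb.1 ?bb.2.
Qed.

Lemma nondegenerate_component_form g :
  nondegenerate b -> nondegenerate (@component_form g (p g)).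
Proof.
move=> nb v v0; apply/val_inj/eqP/negPn/negP => /=.
case/(nondegenerate_homogeneous nb (subvsP v)) => x xg /eqP[].
exact: (v0 (Subvs xg)).
Qed.

End GradedForm.

(** Both restrictions, of b and of its transpose, are nondegenerate, so each of
    the two components embeds into the dual of the other. Hence their
    dimensions agree and both embeddings are onto. *)
Lemma component_perfect (G : groupType) (k : fieldType) (A : falgType k)
    (Gr : grading G A) (b : A -> A -> k^o) (p q : G -> G) (g h : G) :
  bilinear_form b -> nondegenerate b ->
  graded_form Gr b p -> graded_form Gr (fun x a => b a x) q ->
  p g = h -> q h = g ->
  nondegenerate (@component_form _ _ _ Gr b g h) /\
  forall f : 'Hom(subvs_of (Gr h), k^o), exists v : subvs_of (Gr g),
    forall w : subvs_of (Gr h), b (vsval v) (vsval w) = f w.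
Proof.
move=> bb nb bp bq pg qh.
have nb' := nondegenerate_flip bb nb (erefl _).
have bb' := bilinear_flip bb.
have bc := bilinear_component_form Gr bb g h.
have nc : nondegenerate (@component_form _ _ _ Gr b g h).
  by rewrite -pg; apply: nondegenerate_component_form nb.
have nc' : nondegenerate (fun w v => @component_form _ _ _ Gr b g h v w).
  by rewrite -{}qh in nc bc *; apply: (nondegenerate_component_form bb' bq).
split=> //; apply: (nondegenerate_riesz bc nc).
apply/eqP; rewrite eqn_leq (nondegenerate_dim bc nc).
exact: nondegenerate_dim (bilinear_flip bc) nc'.
Qed.

(** * Frobenius functionals *)

Section FrobeniusForm.
Context {G : groupType} {k : fieldType} {A : falgType k} (Gr : grading G A).
Variable s : G.

Definition mul_form (lam : 'Hom(A, k^o)) (a x : A) : k^o := lam (x * a).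

Definition supported_at (lam : 'Hom(A, k^o)) :=
  forall h x, x \in Gr h -> h != s -> lam x = 0.

Lemma bilinear_mul_form lam : bilinear_form (mul_form lam).
Proof.
split=> w x u v; rewrite /mul_form.
  by rewrite mulrDr -scalerAr linearP.
by rewrite mulrDl -scalerAl linearP.
Qed.

Lemma graded_mul_form lam : supported_at lam ->
  graded_form Gr (mul_form lam) (fun g => s * g^-1)%g.
Proof.
move=> lams g h a x ag xh hg; apply: lams (grcompM xh ag) _.
by apply: contraNneq hg => <-; rewrite mulgK.
Qed.

Lemma graded_mul_form_flip lam : supported_at lam ->
  graded_form Gr (fun a x => mul_form lam x a) (fun g => g^-1 * s)%g.
Proof.
move=> lams g h a x ag xh hg; apply: lams (grcompM ag xh) _.
by apply: contraNneq hg => <-; rewrite mulKg.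
Qed.

Lemma left_partner_inj : injective (fun g => s * g^-1)%g.
Proof. by move=> g h /mulgI/invg_inj. Qed.

Lemma right_partner_inj : injective (fun g => g^-1 * s)%g.
Proof. by move=> g h /mulIg/invg_inj. Qed.

Definition frobenius_functional lam :=
  supported_at lam /\ nondegenerate (mul_form lam).

(** Any linear extension of f to A splits into graded parts of the dual; the
    part of degree s^-1 vanishes off A_s and agrees with the extension on A_s. *)
Lemma extend_component_functional (f : 'Hom(subvs_of (Gr s), k^o)) :
  exists lam, supported_at lam /\
    forall v : subvs_of (Gr s), lam (vsval v) = f v.
Proof.
pose F : ldual A := (f \o linfun (vsproj (Gr s)))%VF.
have [t [H [ut HH FE]]] := (dual_direct Gr).1 F.
have E x : (F : 'Hom(A, k^o)) x = \sum_(g <- t) (H g : 'Hom(A, k^o)) x.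
  by rewrite {1}FE sum_lfunE.
(* A degree missing from the support t of F has graded part 0. *)
exists (if s^-1%g \in t then H s^-1%g else 0); split=> [h x xh hs|v].
  case: ifP => _; last by rewrite zero_lfunE.
  by apply: (HH s^-1%g h _ x xh); rewrite invgK.
have <- : (F : 'Hom(A, k^o)) (vsval v) = f v.
  by rewrite comp_lfunE lfunE /= vsvalK.
have H0 g : g != s^-1%g -> (H g : 'Hom(A, k^o)) (vsval v) = 0.
  move=> gs; apply: (HH g s _ _ (subvsP v)).
  by apply: contraNneq gs => ->; rewrite invgK.
rewrite E; case: ifP => st.
  by rewrite (bigD1_seq s^-1%g) //= big1 ?addr0.
rewrite zero_lfunE big_seq big1 // => g gt; apply: H0.
by apply: contraFneq st => <-.
Qed.

(** The functional is the image of 1 under a graded isomorphism, and such a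
    functional gives back the isomorphism a |-> a *: lam. *)
Lemma graded_FrobeniusP :
  graded_Frobenius Gr s <-> exists lam, frobenius_functional lam.
Proof.
split=> [[f [f' [fK _]]]|[lam [lams nb]]].
  pose lam : 'Hom(A, k^o) := f (1 : A^o).
  have fE (a : A) x : (f (a : A^o) : 'Hom(A, k^o)) x = lam (x * a).
    have -> : f (a : A^o) = a *: f (1 : A^o).
      by rewrite -linearZ /= /GRing.scale /= mulr1.
    by rewrite ldual_scaleE.
  exists lam; split=> [h x xh hs|a a0].
    suff lamd : dual_comp Gr s^-1 lam by apply: (lamd h); rewrite ?invgK.
    apply: (grhom_deg f); rewrite /= /suspension_comp mulVg.
    exact: one_in_grcomp.
  apply: (can_inj fK); rewrite linear0.
  by apply/lfunP => x; rewrite fE zero_lfunE; exact: a0.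
have bb := bilinear_mul_form lam.
have bp := graded_mul_form lams.
pose T (a : A^o) : ldual A := (a : A) *: (lam : ldual A).
have TE (a : A) x : (T a : 'Hom(A, k^o)) x = lam (x * a).
  by rewrite ldual_scaleE.
have Tl : linear T.
  by move=> c u v; rewrite /T scalerDl scalerA.
pose T' : {linear (suspension (gr_regular Gr) s) -> gr_dual Gr} :=
  HB.pack T (GRing.isLinear.Build A A^o (ldual A) *:%R T Tl).
have TI : injective T.
  move=> u v Tuv; apply/eqP; rewrite -subr_eq0; apply/eqP/nb => x.
  by rewrite /mul_form mulrBr linearB /= -!TE Tuv subrr.
have [|S TK SK] := inj_surj_bij TI.
  move=> g.
  have [a aE] := nondegenerate_riesz bb nb (erefl _) (g : 'Hom(A, k^o)).
  by exists a; apply/lfunP => x; rewrite TE; exact: aE.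
pose S' : {linear gr_dual Gr -> (suspension (gr_regular Gr) s)} :=
  HB.pack S (GRing.isLinear.Build A (ldual A) A^o *:%R S
    (@can2_linear _ _ _ T' S TK SK)).
have Td g x : grmod_comp (g0 := suspension (gr_regular Gr) s) g x ->
    grmod_comp (g0 := gr_dual Gr) g (T' x).
  move=> xg h hg y yh; rewrite TE; apply: (bp _ _ _ _ xg yh).
  by rewrite invgM mulVKg.
have Sd g x : grmod_comp (g0 := gr_dual Gr) g x ->
    grmod_comp (g0 := suspension (gr_regular Gr) s) g (S' x).
  move=> xg; apply: (nondegenerate_degree bb bp (@left_partner_inj)) => //.
  move=> h y yh; rewrite invgM mulVKg => hg.
  by rewrite /mul_form -TE SK; exact: xg yh.
by exists (GrHom Td), (GrHom Sd).
Qed.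

Lemma frobenius_functional_flip lam : frobenius_functional lam <->
  supported_at lam /\ nondegenerate (fun a x => mul_form lam x a).
Proof.
have bb := bilinear_mul_form lam; have bb' := bilinear_flip bb.
split=> -[lams nb]; split=> //; first exact: nondegenerate_flip bb nb _.
exact: (nondegenerate_flip bb' nb).
Qed.

End FrobeniusForm.

(** * Duality between the components of degree s and e *)

Section ComponentDuality.
Context {G : groupType} {k : fieldType} {A : falgType k} (Gr : grading G A).
Variable s : G.
Local Notation Ae := (subvs_of (grcomp1 Gr)).

(** The isomorphism maps a to x |-> lam (x * a); a witness of nondegeneracy at a
    homogeneous a is also a witness of faithfulness. *)
Lemma component_dual_left lam : frobenius_functional Gr s lam ->
  lmod_iso Ae (lcomp Gr s) (ldual Ae) /\ left_faithful Gr s.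
Proof.
move=> [lams nb]; have bb := bilinear_mul_form lam.
have bp := graded_mul_form lams; have bq := graded_mul_form_flip lams.
split; last first.
  move=> g a ag /(nondegenerate_homogeneous bb bp nb ag)[x xg xa].
  by exists x => //; apply: contraNneq xa => xa; rewrite /mul_form xa linear0.
pose T (a : lcomp Gr s) : ldual Ae :=
  (lam \o amulr (vsval (a : subvs_of (Gr s))) \o linfun vsval)%VF.
have TE a (x : Ae) :
    (T a : 'Hom(Ae, k^o)) x = lam (vsval x * vsval (a : subvs_of (Gr s))).
  by rewrite !comp_lfunE !lfunE.
have Tl : linear T.
  move=> c u v; apply/lfunP => x; rewrite add_lfunE ldual_scaleE !TE /=.
  by rewrite mulrDr linearD mulrA.
pose T' : {linear lcomp Gr s -> ldual Ae} :=
  HB.pack T (GRing.isLinear.Build Ae (lcomp Gr s) (ldual Ae) *:%R T Tl).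
have s1 : (1^-1 * s)%g = s by rewrite invg1 mul1g.
have [nc riesz] := component_perfect bb nb bp bq (mulgV s) s1.
exists T'; apply: inj_surj_bij => [u v Tuv|f].
  apply/eqP; rewrite -subr_eq0; apply/eqP/nc => x.
  by rewrite /component_form /mul_form linearB mulrBr linearB /= -!TE [T u]Tuv
    subrr.
by have [a aE] := riesz f; exists a; apply/lfunP => x; rewrite TE; exact: aE.
Qed.

(** This uses the transpose of the form used on the left; it is nondegenerate as
    well, and the partner maps are exchanged. *)
Lemma component_dual_right lam : frobenius_functional Gr s lam ->
  lmod_iso (Ae^c)%type (rcomp Gr s) (rdual Ae) /\ right_faithful Gr s.
Proof.
move=> lamF; have [lams nb] := (frobenius_functional_flip _ _ _).1 lamF.
have bb := bilinear_flip (bilinear_mul_form lam).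
have bp := graded_mul_form_flip lams; have bq := graded_mul_form lams.
split; last first.
  move=> g a ag /(nondegenerate_homogeneous bb bp nb ag)[x xg xa].
  by exists x => //; apply: contraNneq xa => xa; rewrite /mul_form xa linear0.
pose T (a : rcomp Gr s) : rdual Ae :=
  (lam \o amull (vsval (a : subvs_of (Gr s))) \o linfun vsval)%VF.
have TE a (x : Ae) :
    (T a : 'Hom(Ae, k^o)) x = lam (vsval (a : subvs_of (Gr s)) * vsval x).
  by rewrite !comp_lfunE !lfunE.
have Tl : linear T.
  move=> c u v; apply/lfunP => x; rewrite add_lfunE rdual_scaleE !TE /=.
  by rewrite mulrDl linearD mulrA.
pose T' : {linear rcomp Gr s -> rdual Ae} :=
  HB.pack T
    (GRing.isLinear.Build (Ae^c)%type (rcomp Gr s) (rdual Ae) *:%R T Tl).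
have s1 : (s * 1^-1)%g = s by rewrite invg1 mulg1.
have [nc riesz] := component_perfect bb nb bp bq (mulVg s) s1.
exists T'; apply: inj_surj_bij => [u v Tuv|f].
  apply/eqP; rewrite -subr_eq0; apply/eqP/nc => x.
  by rewrite /component_form /mul_form linearB mulrBl linearB /= -!TE [T u]Tuv
    subrr.
by have [a aE] := riesz f; exists a; apply/lfunP => x; rewrite TE; exact: aE.
Qed.

(** Faithfulness moves a nonzero homogeneous element into A_s without killing
    it, and there the isomorphism detects it. *)
Lemma frobenius_of_left_dual : lmod_iso Ae (lcomp Gr s) (ldual Ae) ->
  left_faithful Gr s -> exists lam, frobenius_functional Gr s lam.
Proof.
move=> [phi phi_bij] faith.
pose ev (a : subvs_of (Gr s)) : k^o := (phi (a : lcomp Gr s) : 'Hom(Ae, k^o)) 1.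
have evE (x : Ae) (a : lcomp Gr s) : ev (x *: a) = (phi a : 'Hom(Ae, k^o)) x.
  by rewrite -[x in RHS]mul1r -(ldual_scaleE x (phi a)) /ev linearZ.
(* k acts on A_s through its image in A_e, so the A_e-linear phi is k-linear. *)
have /functional_of_linear[f fE] : linear ev.
  move=> c u v; have -> : c *: u + v = (c%:A : Ae) *: (u : lcomp Gr s) + v.
    by apply: val_inj; rewrite /= -[LHS]/(_ + _) algid_grcomp1 -scalerAl mul1r.
  rewrite /ev linearD add_lfunE -/(ev _) evE linearZ /=.
  by rewrite -[X in _ *: _ X]mul1r.
have [lam [lams lamE]] := extend_component_functional f.
exists lam; split=> //.
apply: (homogeneous_nondegenerate (bilinear_mul_form lam) (graded_mul_form lams)
  (@left_partner_inj _ s)) => g a ag a0.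
have [y yg ya0] := faith g a ag a0.
have yas : y * a \in Gr s by rewrite -(mulgVK g s) grcompM.
pose u : lcomp Gr s := Subvs yas.
have [|x xu] := @nonzero_functional _ _ (phi u : 'Hom(Ae, k^o)).
  apply: contraNneq ya0 => pu0; have : u = 0.
    by apply: (bij_inj phi_bij); rewrite linear0; exact: pu0.
  by move/(congr1 (@vsval _ _ _)) => /= ->.
exists (vsval x * y); first by rewrite -[X in Gr X]mul1g grcompM ?subvsP.
rewrite /mul_form -mulrA -[_ * _]/(vsval (x *: u : subvs_of (Gr s))).
by rewrite lamE fE evE.
Qed.

(** The right-hand data show that the transposed form is nondegenerate, which
    makes lam a Frobenius functional by the symmetry of nondegeneracy. *)
Lemma frobenius_of_right_dual : lmod_iso (Ae^c)%type (rcomp Gr s) (rdual Ae) ->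
  right_faithful Gr s -> exists lam, frobenius_functional Gr s lam.
Proof.
move=> [phi phi_bij] faith.
pose ev (a : subvs_of (Gr s)) : k^o := (phi (a : rcomp Gr s) : 'Hom(Ae, k^o)) 1.
have evE (x : Ae) (a : rcomp Gr s) :
    ev ((x : Ae^c) *: a) = (phi a : 'Hom(Ae, k^o)) x.
  by rewrite -[x in RHS]mulr1 -(rdual_scaleE x (phi a)) /ev linearZ.
(* k acts on A_s through its image in A_e, so the A_e-linear phi is k-linear. *)
have /functional_of_linear[f fE] : linear ev.
  move=> c u v.
  have -> : c *: u + v = ((c%:A : Ae) : Ae^c) *: (u : rcomp Gr s) + v.
    by apply: val_inj; rewrite /= -[LHS]/(_ + _) algid_grcomp1 -scalerAr mulr1.
  rewrite /ev linearD add_lfunE -/(ev _) evE linearZ /=.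
  by rewrite -[X in _ *: _ X]mul1r.
have [lam [lams lamE]] := extend_component_functional f.
exists lam; apply/frobenius_functional_flip; split=> //.
apply: (homogeneous_nondegenerate (bilinear_flip (bilinear_mul_form lam))
  (graded_mul_form_flip lams) (@right_partner_inj _ s)) => g a ag a0.
have [y yg ay0] := faith g a ag a0.
have ays : a * y \in Gr s by rewrite -(mulVKg g s) grcompM.
pose u : rcomp Gr s := Subvs ays.
have [|x xu] := @nonzero_functional _ _ (phi u : 'Hom(Ae, k^o)).
  apply: contraNneq ay0 => pu0; have : u = 0.
    by apply: (bij_inj phi_bij); rewrite linear0; exact: pu0.
  by move/(congr1 (@vsval _ _ _)) => /= ->.
exists (y * vsval x); first by rewrite -[X in Gr X]mulg1 grcompM ?subvsP.
rewrite /mul_form mulrA -[_ * _]/(vsval ((x : Ae^c) *: u : subvs_of (Gr s))).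
by rewrite lamE fE evE.
Qed.

End ComponentDuality.

Theorem theorem4p3 (G : groupType) (k : fieldType) (A : falgType k)
    (Gr : grading G A) (s : G) :
  (graded_Frobenius Gr s <->
     lmod_iso (subvs_of (grcomp1 Gr))
       (lcomp Gr s) (ldual (subvs_of (grcomp1 Gr))) /\
     left_faithful Gr s) /\
  (graded_Frobenius Gr s <->
     lmod_iso ((subvs_of (grcomp1 Gr))^c)%type
       (rcomp Gr s) (rdual (subvs_of (grcomp1 Gr))) /\
     right_faithful Gr s).
Proof.
split; split.
- by case/graded_FrobeniusP => lam /component_dual_left.
- by case=> iso faith; apply/graded_FrobeniusP/frobenius_of_left_dual.
- by case/graded_FrobeniusP => lam /component_dual_right.
- by case=> iso faith; apply/graded_FrobeniusP/frobenius_of_right_dual.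
Qed.
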